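(* Let $n \geq 3$ be an integer. Then the number of equivalence classes of $C_n$ under $\equiv_S$ is \[ |C_n/\!\equiv_S| = \frac{1}{4n^2}\left[\sum_{d\mid n}\left(\phi\!\left(\frac{n}{d}\right)\right)^2\left(\frac{n}{d}\right)^d d! + \begin{cases} n!!\,\frac{n(n+6)}{4}, & \text{if $n$ is even;}\\ n^2 (n-1)!!, & \text{if $n$ is odd.}\end{cases}\right] \]
   Context: Identify the vertices of the complete graph $K_n$ with $n$ regularly spaced points on a circle, labelled $0,1,\dots,n-1$ in cyclic order (the geometric realization); edges are drawn as line segments. $C_n$ denotes the set of subgraphs of $K_n$ induced by Hamiltonian cycles: the subgraph has all $n$ vertices and exactly the edges traversed by the cycle. Two subgraphs $G_1,G_2$ are similar, $G_1 \equiv_S G_2$, if one is obtained from the other by a rotation or reflection of the regular $n$-gon of vertices, i.e. by applying to the vertex labels a map $x \mapsto \pm x + k \pmod n$. $\phi$ is Euler's totient function, the sum is over positive divisors $d$ of $n$, and for a positive integer $m$, $m!!$ denotes the product of $m$ with all positive integers less than $m$ of the same parity as $m$. *)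

(* Defs.v *)
From mathcomp Require Import all_boot all_order all_algebra.

Set Implicit Arguments.
Unset Strict Implicit.
Unset Printing Implicit Defensive.

Import GRing.Theory.
Local Open Scope ring_scope.

(* The n points on the circle are labelled by 'Z_n, which has n elements only *)
(* when n > 1.                                                                *)

Definition complete_graph (n : nat) : rel 'Z_n := fun x y => x != y.

(* A subgraph is its vertex set together with its set of edges, an edge being *)
(* the unordered pair of its endpoints.                                       *)
Notation subgraph n := ({set 'Z_n} * {set {set 'Z_n}})%type.

Definition hamiltonian_cycle (n : nat) (c : n.-tuple 'Z_n) : bool :=
  ucycleb (@complete_graph n) c && [forall x : 'Z_n, x \in c].

Definition cycle_subgraph (n : nat) (c : n.-tuple 'Z_n) : subgraph n :=
  ([set x in c], [set [set x; next c x] | x in c]).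

Definition ham_subgraphs (n : nat) : {set subgraph n} :=
  [set cycle_subgraph c | c : n.-tuple 'Z_n & hamiltonian_cycle c].

Definition dihedral_map (n : nat) (s : bool) (k x : 'Z_n) : 'Z_n :=
  (if s then - x else x) + k.

Definition relabel (n : nat) (f : 'Z_n -> 'Z_n) (G : subgraph n) : subgraph n :=
  (f @: G.1, [set f @: e | e : {set 'Z_n} in G.2]).

Definition similar_subgraphs (n : nat) : rel (subgraph n) :=
  fun G1 G2 => [exists s : bool, exists k : 'Z_n,
    G2 == relabel (dihedral_map s k) G1].

Definition double_factorial (m : nat) : nat :=
  (\prod_(1 <= i < m.+1 | odd i == odd m) i)%N.

Lemma relabel_comp (n : nat) (f g : 'Z_n -> 'Z_n) (G : subgraph n) :
  relabel f (relabel g G) = relabel (f \o g) G.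
Proof.
rewrite /relabel /= -!imset_comp; congr (_, _).
by apply: eq_imset => e /=; rewrite -imset_comp.
Qed.

Lemma eq_relabel (n : nat) (f g : 'Z_n -> 'Z_n) (G : subgraph n) :
  f =1 g -> relabel f G = relabel g G.
Proof.
move=> fg; rewrite /relabel (eq_imset _ fg); congr (_, _).
by apply: eq_imset => e; apply: eq_imset.
Qed.

Lemma relabel_id (n : nat) (G : subgraph n) : relabel id G = G.
Proof.
case: G => V E; rewrite /relabel /= imset_id; congr (_, _).
by rewrite -[RHS]imset_id; apply: eq_imset => e; rewrite imset_id.
Qed.

(* equivalence_partition is meaningful only for an equivalence relation.      *)
Lemma similar_subgraphs_equivalence (n : nat) : equivalence_rel (@similar_subgraphs n).
Proof.
have simP G H : reflect (exists s k, H = relabel (dihedral_map s k) G)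
                        (@similar_subgraphs n G H).
  apply: (iffP existsP) => [[s /existsP[k /eqP->]]|[s [k ->]]].
    by exists s, k.
  by exists s; apply/existsP; exists k.
have trans G H K : @similar_subgraphs n G H -> @similar_subgraphs n H K -> @similar_subgraphs n G K.
  case/simP=> s [k ->] /simP[t [l ->]]; apply/simP.
  exists (s (+) t), (dihedral_map t l k).
  rewrite relabel_comp; apply: eq_relabel => x; rewrite /dihedral_map /=.
  by case: s t => [] [] /=; rewrite ?opprD ?opprK addrA.
have sym G H : @similar_subgraphs n G H -> @similar_subgraphs n H G.
  case/simP=> s [k ->]; apply/simP; exists s, (if s then k else - k).
  rewrite relabel_comp -[LHS]relabel_id; apply: eq_relabel => x.
  by rewrite /dihedral_map /=; case: s; rewrite ?opprD ?opprK ?addrNK ?addrK.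
move=> G H K; split.
  apply/simP; exists false, 0; rewrite -[LHS]relabel_id.
  by apply: eq_relabel => x; rewrite /dihedral_map addr0.
by move=> GH; apply/idP/idP; apply: trans => //; apply: sym.
Qed.

(* Main.v *)
Require Import Defs.
From mathcomp Require Import all_boot all_order all_algebra all_fingroup.
From mathcomp Require Import zify ring.

Set Implicit Arguments.
Unset Strict Implicit.
Unset Printing Implicit Defensive.

Import GRing.Theory.

(** A permutation [s] of Z/n traces the Hamiltonian cycle s 0, s 1, ..., and two
    permutations trace the same subgraph iff they differ by precomposition with
    a dihedral map, because an automorphism of the n-cycle is dihedral.  Hence
    similarity classes are the orbits of D_n x D_n acting on Sym(Z/n) on both
    sides, and Burnside reduces the count to the sum over pairs (g, h) in
    D_n x D_n of the number of [s] conjugating g to h.  In every dihedral map all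
    nontrivial cycles have the same length m; if g and h both have f fixed
    points and d such cycles, there are f! d! m^d conjugators, and there are none
    when the cycle types differ.  Rotations give the sum over divisors; the other
    term comes from pairs of reflections and, for n even, from the half turn
    paired with the reflections without fixed points. *)

(** * Permutations intertwining two permutations *)

Lemma inr_pair_inj (A B C : Type) (b b' : B) (c c' : C) :
  @inr A (B * C) (b, c) = inr (b', c') -> b = b' /\ c = c'.
Proof. by case. Qed.

Section Intertwiners.
Variable T : finType.
Implicit Types g h s : {perm T}.

Definition intertwiners g h : {set {perm T}} := [set s | g * s == s * h]%g.

Definition fixpoints g : {set T} := [set x | g x == x].

(** Every point moved by [g] has period exactly [m]. Fixed points are exempt, so the identity
    qualifies for every [m]. *)
Definition cycles_of_length (m : nat) g :=
  forall x j, g x != x -> ((g ^+ j)%g x == x) = (m %| j).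

Lemma intertwinersP g h s :
  reflect (forall x, s (g x) = h (s x)) (s \in intertwiners g h).
Proof.
rewrite inE; apply: (iffP eqP) => [E x|E]; first by rewrite -!permM E.
by apply/permP => x; rewrite !permM.
Qed.

Lemma card_intertwinersC g h : #|intertwiners g h| = #|intertwiners h g|.
Proof.
rewrite -(card_imset _ (@invg_inj {perm T})); apply: eq_card => s.
apply/imsetP/idP => [[t /[!inE]/eqP E ->]|/[!inE]/eqP E].
  by apply/eqP; rewrite -{1}[h](mulKg t) -E -!mulgA mulgV mulg1.
exists s^-1%g; rewrite ?invgK// inE; apply/eqP.
by rewrite -{1}[g](mulKg s) -E -!mulgA mulgV mulg1.
Qed.

Lemma intertwiners_expg g h s j x :
  s \in intertwiners g h -> s ((g ^+ j)%g x) = (h ^+ j)%g (s x).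
Proof.
move=> /intertwinersP E; elim: j => [|j IH]; first by rewrite !expg0 !perm1.
by rewrite !expgSr !permM E IH.
Qed.

Lemma intertwiners_fixpoints g h s :
  s \in intertwiners g h -> #|fixpoints g| = #|fixpoints h|.
Proof.
move=> /intertwinersP E; rewrite -(card_imset _ (@perm_inj _ s)).
apply: eq_card => x; apply/imsetP/idP => [[y /[!inE]/eqP E' ->]|].
  by rewrite -E E'.
rewrite inE => /eqP E'; exists (s^-1%g x); rewrite ?permKV// inE.
by apply/eqP/(@perm_inj _ s); rewrite E permKV.
Qed.

(** [s] carries the cycle of [x] under [g] to the cycle of [s x] under [h], so [m] and [m'] divide
    the same exponents. *)
Lemma intertwiners_length g h s x m m' :
    s \in intertwiners g h -> g x != x ->
  cycles_of_length m g -> cycles_of_length m' h -> m = m'.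
Proof.
move=> sgh gx mg m'h; have hx : h (s x) != s x.
  by rewrite -(intertwinersP _ _ _ sgh) (inj_eq perm_inj).
have E j : (m %| j) = (m' %| j).
  rewrite -(mg x)// -(m'h (s x))// -(intertwiners_expg _ _ sgh).
  by rewrite (inj_eq perm_inj).
by apply/eqP; rewrite eqn_dvd E dvdnn -E dvdnn.
Qed.

(** Normal form of a permutation with [f] fixed points and [d] cycles of length [m.+2]. The length
    is at least 2, so ['I_m.+2] is a ring with 1 != 0 and the shift moves every point of a cycle. *)
Definition cycle_model (f d m : nat) : finType := ('I_f + 'I_d * 'I_m.+2)%type.

Definition model_shift f d m (u : cycle_model f d m) : cycle_model f d m :=
  match u with inl i => inl i | inr (i, a) => inr (i, (a + 1)%R) end.

(** Choose a base point on each nontrivial cycle and send [(i, a)] to the image of the [i]-th base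
    point under [g ^+ a]. The exact cycle length gives injectivity. *)
Lemma cycle_modelP g m f d :
    cycles_of_length m.+2 g -> #|fixpoints g| = f -> f + d * m.+2 = #|T| ->
  exists2 b : cycle_model f d m -> T,
    bijective b & forall u, b (@model_shift f d m u) = g (b u).
Proof.
move=> mg <- cT.
(* The pick depends only on the orbit as a set, so [r] is constant on orbits; the default [x] is
   never reached. *)
pose r x := odflt x [pick y in porbit g x].
have rin x : r x \in porbit g x.
  by rewrite /r; case: pickP => [y //|/(_ x)]; rewrite porbit_id.
have rE x y : x \in porbit g y -> r x = r y.
  rewrite -eq_porbit_mem => /eqP E; rewrite /r E.
  by case: pickP => // /(_ y); rewrite porbit_id.
have gM x j : g x != x -> (g ^+ j)%g x = (g ^+ (j %% m.+2))%g x.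
  move=> gx; rewrite {1}(divn_eq j m.+2) expgD permM; congr (fun_of_perm _ _).
  by apply/eqP; rewrite mg// dvdn_mull.
pose X := [set x | (g x != x) && (r x == x)].
pose b (u : cycle_model #|fixpoints g| #|X| m) : T :=
  match u with inl i => enum_val i | inr (i, a) => (g ^+ (a : nat))%g (enum_val i) end.
have gX (i : 'I_#|X|) : g (enum_val i) != enum_val i.
  by have := enum_valP i; rewrite inE => /andP[].
have rX (i : 'I_#|X|) : r (enum_val i) = enum_val i.
  by have := enum_valP i; rewrite inE => /andP[_ /eqP].
have gpX j (i : 'I_#|X|) : g ((g ^+ j)%g (enum_val i)) != (g ^+ j)%g (enum_val i).
  by rewrite -permM -expgSr expgS permM (inj_eq perm_inj).
have bg u : b (@model_shift _ _ m u) = g (b u).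
  case: u => [i|[i a]] /=.
    by have := enum_valP i; rewrite inE => /eqP.
  by rewrite -permM -expgSr [RHS]gM//= modnS addn1.
have b_inj : injective b.
  move=> [i|[i a]] [j|[j c]] /= E.
  - by congr inl; apply: enum_val_inj.
  - by have := enum_valP i; rewrite inE E (negPf (gpX _ _)).
  - by have := enum_valP j; rewrite inE -E (negPf (gpX _ _)).
  have Eij : i = j.
    apply: enum_val_inj; rewrite -rX -[RHS]rX.
    by rewrite -(rE _ _ (mem_porbit g a _)) E (rE _ _ (mem_porbit g c _)).
  subst j; congr (inr (_, _)); apply/val_inj => /=.
  (* If a <= c, then [g ^+ (c - a)] fixes the base point, so [m.+2] divides c - a < [m.+2], and a =
     c. *)
  wlog le_ac : a c E / a <= c.
    by move=> H; case: (leqP a c) => [/H->|/ltnW /H->].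
  move: E; rewrite -(subnK le_ac) expgD permM => /perm_inj /esym/eqP.
  rewrite mg//; have := ltn_ord c; have := ltn_ord a.
  move: (a : nat) (c : nat) le_ac => a' c' H1 H2 H3 /dvdnP[[|k]]; first by lia.
  by rewrite mulSn; lia.
have b_surj y : y \in codom b.
  apply/codomP; have [gy|gy] := boolP (y \in fixpoints g).
    by exists (inl (enum_rank_in gy y)); rewrite /= enum_rankK_in.
  have ryX : r y \in X.
    rewrite inE (rE _ _ (rin y)) eqxx andbT.
    have /porbitP[j ->] := rin y.
    rewrite -permM -expgSr expgS permM (inj_eq perm_inj).
    by move: gy; rewrite inE.
  have /porbitP[j yE] : y \in porbit g (r y) by rewrite porbit_sym.
  exists (inr (enum_rank_in ryX (r y), inZp j)).
  rewrite /= enum_rankK_in//= -gM//.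
  by move: ryX; rewrite inE => /andP[].
have cE : #|{: cycle_model #|fixpoints g| #|X| m}| = #|T|.
  by rewrite -(card_codom b_inj); apply: eq_card => y; rewrite b_surj.
have Ed : d = #|X|.
  (* Counting [T] through the model forces the number of nontrivial cycles to be the given [d]. *)
  move: cE; rewrite card_sum card_prod !card_ord -cT => /addnI/eqP.
  by rewrite eqn_mul2r => /eqP.
subst d; exists b => //; apply: inj_card_bij => //.
by rewrite cE.
Qed.

(** In model coordinates an intertwiner is a permutation commuting with the shift. Such a
    permutation amounts to a permutation of the fixed points, a permutation of the cycles, and a
    rotation amount for each cycle. *)
Lemma card_intertwiners g h m f d :
    cycles_of_length m.+2 g -> cycles_of_length m.+2 h ->
    #|fixpoints g| = f -> #|fixpoints h| = f -> f + d * m.+2 = #|T| ->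
  #|intertwiners g h| = f`! * (d`! * m.+2 ^ d).
Proof.
move=> mg mh fg fh cT.
have [b [b' bK b'K] bg] := cycle_modelP mg fg cT.
have [c [c' cK c'K] ch] := cycle_modelP mh fh cT.
pose M := cycle_model f d m.
pose P : finType := ('S_f * ('S_d * {ffun 'I_d -> 'I_m.+2}))%type.
pose act (p : P) (u : M) : M := match u with
  | inl i => inl (p.1 i) | inr (i, a) => inr (p.2.1 i, (a + p.2.2 i)%R) end.
have act_inj p : injective (act p).
  move=> [i|[i a]] [j|[j a']]; rewrite /act => E; first 1 last.
  - by [].
  - by [].
  - by have [/perm_inj Eij] := inr_pair_inj E; rewrite Eij => /addIr->.
  by case: E => /perm_inj->.
have F_inj p : injective (c \o act p \o b').
  exact: inj_comp (inj_comp (can_inj cK) (act_inj p)) (can_inj b'K).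
pose F p := perm (F_inj p).
have FE p x : F p x = c (act p (b' x)) by rewrite permE.
have Finj : injective F.
  move=> p q E; have Eact u : act p u = act q u.
    by apply: (can_inj cK); rewrite -[u]bK -!FE E.
  case: p q Eact {E} => [p1 [p2 p3]] [q1 [q2 q3]] E.
  congr (_, (_, _)).
  - by apply/permP => i; case: (E (inl i)).
  - by apply/permP => i; have [] := inr_pair_inj (E (inr (i, 0%R))).
  - by apply/ffunP => i; have [_ Ei] := inr_pair_inj (E (inr (i, 0%R))); apply: addrI Ei.
have <- : #|P| = f`! * (d`! * m.+2 ^ d).
  rewrite !card_prod card_ffun !card_ord.
  by rewrite -!(card_Sn) -!cardsT.
rewrite -cardsT -(card_imset _ Finj); apply: eq_card => s.
apply/idP/imsetP => [/intertwinersP E|[p _ ->]]; last first.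
  apply/intertwinersP => x; rewrite !FE -ch; congr c.
  rewrite -{1}[x]b'K -bg bK.
  by case: (b' x) => [i|[i a]] //=; rewrite addrAC.
(* [t] is [s] read in the model. It commutes with the shift, hence maps fixed points to fixed points
   and is determined on each cycle by the image of [(i, 0)]. *)
pose t u := c' (s (b u)).
have tS u : t (@model_shift f d m u) = @model_shift f d m (t u).
  by rewrite /t bg E; apply: (can_inj cK); rewrite ch !c'K.
have t_inj : injective t.
  by move=> u v /(can_inj c'K)/perm_inj/(can_inj bK).
have neqS (a : 'I_m.+2) : (a + 1)%R <> a.
  by rewrite -[X in _ = X]addr0 => /addrI/eqP; rewrite oner_eq0.
have tl i : {j | t (inl i) = inl j}.
  case Et: (t (inl i)) => [j|[j a]]; first by exists j.
  by have := tS (inl i); rewrite /= Et /= => Ea; have [_ /esym/neqS] := inr_pair_inj Ea.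
have tr i : {ja : 'I_d * 'I_m.+2 | t (inr (i, 0%R)) = inr ja}.
  case Et: (t (inr (i, 0%R))) => [j|ja]; last by exists ja.
  have := tS (inr (i, 0%R)); rewrite /= Et /= -Et => /t_inj Ei; have [_] := inr_pair_inj Ei.
  by rewrite add0r => /eqP; rewrite oner_eq0.
have q_inj : injective (fun i => sval (tl i)).
  move=> i j; case: (tl i) (tl j) => k Ek [l El] /= Ekl.
  by have /t_inj[] : t (inl i) = t (inl j) by rewrite Ek El Ekl.
have trS i (a : nat) : t (inr (i, a%:R%R)) = inr ((sval (tr i)).1, (a%:R + (sval (tr i)).2)%R).
  elim: a => [|a IH]; first by rewrite add0r; case: (tr i) => -[].
  by have := tS (inr (i, a%:R%R)); rewrite IH /= -natr1 => ->; rewrite addrAC.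
have Zn (a : 'I_m.+2) : a = (a : nat)%:R%R by rewrite -[LHS](natr_Zp a).
have p_inj : injective (fun i => (sval (tr i)).1).
  move=> i j Eij; have := trS i; have := trS j; rewrite -Eij.
  set x := (sval (tr i)).2; set y := (sval (tr j)).2 => Ej Ei.
  (* If cycles [i] and [j] had the same image cycle, moving along cycle [i] by [y - x] would reach
     the image of the base point of [j]. *)
  have /t_inj E' : t (inr (i, (nat_of_ord (y - x)%R)%:R%R)) = t (inr (j, (0%:R)%R)).
    by rewrite Ei Ej -Zn subrK add0r.
  by have [] := inr_pair_inj E'.
exists (perm q_inj, (perm p_inj, [ffun i => (sval (tr i)).2])) => //.
apply/permP => x; rewrite FE; apply: (can_inj c'K); rewrite cK.
rewrite -{1}[x]b'K -/(t _); case: (b' x) => [i|[i a]] /=.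
  by rewrite permE; case: (tl i).
by rewrite permE ffunE {1}[a]Zn trS -Zn.
Qed.

End Intertwiners.

(** * Cycle subgraphs as two-sided dihedral orbits *)

Section TwoSidedAction.
Variable gT : finGroupType.

(* With permM : (s * t) x = t (s x), a.1 reparametrizes and a.2 relabels. *)
Definition two_sided (s : gT) (a : gT * gT) : gT := (a.1^-1 * s * a.2)%g.

Lemma two_sided_is_total_action :
  two_sided^~ 1%g =1 id /\ (forall s, act_morph two_sided s).
Proof.
split=> [s|s a b]; rewrite /two_sided /=; first by rewrite invg1 mul1g mulg1.
by rewrite invMg !mulgA.
Qed.

Canonical two_sided_action :=
  TotalAction two_sided_is_total_action.1 two_sided_is_total_action.2.

End TwoSidedAction.

Section CycleGraphs.
Variable p : nat.
Local Notation n := p.+3.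
Implicit Types s t g h : {perm 'Z_n}.

Lemma dihedral_map_inj (e : bool) (k : 'Z_n) : injective (dihedral_map e k).
Proof. by case: e => x y /addIr; [apply: oppr_inj|]. Qed.

Definition dihedral_perm (e : bool) (k : 'Z_n) : {perm 'Z_n} :=
  perm (@dihedral_map_inj e k).

Definition dihedral : {set {perm 'Z_n}} :=
  [set dihedral_perm a.1 a.2 | a : bool * 'Z_n].

Lemma dihedralP s :
  reflect (exists e k, s =1 dihedral_map e k) (s \in dihedral).
Proof.
apply: (iffP imsetP) => [[[e k] _ ->]|[e [k E]]].
  by exists e, k => x; rewrite permE.
by exists (e, k) => //; apply/permP => x; rewrite permE E.
Qed.

Lemma dihedral_group_set : group_set dihedral.
Proof.
apply/group_setP; split.
  by apply/dihedralP; exists false, 0%R => x; rewrite perm1 /dihedral_map addr0.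
move=> _ _ /imsetP[[s k] _ ->] /imsetP[[t l] _ ->]; apply/dihedralP.
exists (s (+) t), (dihedral_map t l k) => x.
rewrite permM !permE /dihedral_map /=.
by case: s t => [] [] /=; rewrite ?opprD ?opprK addrA.
Qed.

Canonical dihedral_group := Group dihedral_group_set.

Lemma Zp_two_neq0 : (2 : 'Z_n)%R != 0%R.
Proof. by []. Qed.

(** The value at 0 gives [k]; the value at 1 then gives the sign, because 1 != -1 when n >= 3. *)
Lemma dihedral_perm_inj : injective (fun a : bool * 'Z_n => dihedral_perm a.1 a.2).
Proof.
move=> [e k] [e' k'] /= /permP E.
have := E 0%R; have := E 1%R; rewrite !permE /dihedral_map.
have E1 : (1 : 'Z_n)%R != (- 1)%R.
  by rewrite -subr_eq0 opprK -(natrD _ 1 1).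
have E2 : (- 1 : 'Z_n)%R != 1%R by rewrite eq_sym.
case: e e' {E} => [] [] /=; rewrite ?oppr0 !add0r => + Ek; subst k' => //.
  by move=> /addIr/eqP; rewrite (negPf E2).
by move=> /addIr/eqP; rewrite (negPf E1).
Qed.

Lemma card_dihedral : #|dihedral| = 2 * n.
Proof.
by rewrite (card_imset _ dihedral_perm_inj) card_prod card_bool card_ord.
Qed.

Definition perm_cycle_graph s : subgraph n :=
  ([set: 'Z_n], [set [set s i; s (i + 1)%R] | i : 'Z_n]).

Lemma relabel_perm_cycle_graph g s :
  relabel g (perm_cycle_graph s) = perm_cycle_graph (s * g)%g.
Proof.
rewrite /relabel /perm_cycle_graph /=; congr (_, _).
  by apply/setP => x; rewrite inE -[x](permKV g) imset_f ?inE.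
rewrite -imset_comp; apply: eq_imset => i /=.
by rewrite imsetU !imset_set1 !permM.
Qed.

Lemma nth_next_tuple (c : n.-tuple 'Z_n) (i : 'Z_n) :
  uniq c -> next c (tnth c i) = tnth c (i + 1)%R.
Proof.
move=> Uc; rewrite next_nth mem_tnth.
have ic : index (tnth c i) c = i by rewrite (tnth_nth 0%R) index_uniq ?size_tuple.
rewrite ic [RHS](tnth_nth 0%R).
have := size_tuple c; case: (tval c) => [//|y c'] [szc].
rewrite [in RHS]/= addn1.
(* At the last index [nth] runs past the tail and returns its default, the head of the tuple: this
   is the wrap-around of [i + 1]. *)
have := ltn_ord i; rewrite ltnS leq_eqVlt => /orP[/eqP Ei|lti].
  by rewrite Ei modnn /= nth_default ?szc.
rewrite modn_small //=; apply: set_nth_default.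
by rewrite szc.
Qed.

Lemma ham_subgraphsE : ham_subgraphs n = [set perm_cycle_graph s | s : {perm 'Z_n}].
Proof.
have E (c : n.-tuple 'Z_n) s : uniq c -> (forall i, tnth c i = s i) ->
    cycle_subgraph c = perm_cycle_graph s.
  move=> Uc cs; have c_all x : x \in c by rewrite -[x](permKV s) -cs mem_tnth.
  rewrite /cycle_subgraph /perm_cycle_graph; congr (_, _).
    by apply/setP => x; rewrite !inE c_all.
  apply/setP => e; apply/imsetP/imsetP => [[x _ ->]|[i _ ->]].
    by exists (s^-1%g x) => //; rewrite -!cs -nth_next_tuple// !cs permKV.
  by exists (s i); rewrite ?c_all// -!cs nth_next_tuple.
apply/setP => G; apply/imsetP/imsetP => [[c]|[s _ ->]].
  rewrite inE => /andP[/andP[_ Uc] _] ->.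
  have c_inj : injective (tnth c) by apply/tuple_uniqP.
  by exists (perm c_inj) => //; apply: E => // i; rewrite permE.
pose c : n.-tuple 'Z_n := [tuple s i | i < n].
have cs i : tnth c i = s i by rewrite tnth_mktuple.
have Uc : uniq c by apply/tuple_uniqP => i j; rewrite !cs => /perm_inj.
exists c; last by rewrite (E c s).
rewrite inE /hamiltonian_cycle /ucycleb Uc andbT; apply/andP; split.
  apply: cycle_from_next => // _ /tnthP[i ->].
  rewrite nth_next_tuple// !cs /complete_graph (inj_eq perm_inj).
  by rewrite -subr_eq0 opprD addrA subrr sub0r oppr_eq0 oner_eq0.
by apply/forallP => x; rewrite -[x](permKV s) -cs mem_tnth.
Qed.

(** Each step of [s] is +1 or -1, and injectivity forbids a change of sign, so [s] is affine with
    slope 1 or -1. *)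
Lemma cycle_automorphism_dihedral s :
    (forall i, exists j, [set s i; s (i + 1)%R] = [set j; (j + 1)%R]) ->
  s \in dihedral.
Proof.
move=> H.
have step i : s (i + 1)%R = (s i + 1)%R \/ s (i + 1)%R = (s i - 1)%R.
  have [j Ej] := H i.
  have : s (i + 1)%R != s i.
    by rewrite (inj_eq perm_inj) -subr_eq0 addrAC subrr add0r oner_eq0.
  have : s i \in [set j; (j + 1)%R] by rewrite -Ej !inE eqxx.
  have : s (i + 1)%R \in [set j; (j + 1)%R] by rewrite -Ej !inE eqxx orbT.
  rewrite !inE => /orP[]/eqP-> /orP[]/eqP->; rewrite ?eqxx // => _.
    by right; rewrite addrK.
  by left.
(* Two consecutive steps of opposite signs would give s (i + 2) = s i. *)
have turn i e : s (i + 1)%R = (s i + e)%R -> e = 1%R \/ e = (-1)%R ->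
    s (i + 1 + 1)%R = (s (i + 1) + e)%R.
  move=> E1 He; have : s (i + 1 + 1)%R != s i.
    rewrite (inj_eq perm_inj) -addrA -subr_eq0 addrAC subrr add0r.
    exact: Zp_two_neq0.
  move: (step (i + 1)%R); rewrite E1; case: He => -> [] -> //;
  by rewrite ?addrK ?addrNK eqxx.
have lin (e : 'Z_n) : s (0 + 1)%R = (s 0 + e)%R -> e = 1%R \/ e = (-1)%R ->
    forall i : nat, s (i%:R + 1)%R = (s i%:R + e)%R.
  by move=> E0 He; elim=> [//|i IH]; rewrite -natr1; apply: turn.
have fin (e : 'Z_n) : s (0 + 1)%R = (s 0 + e)%R -> e = 1%R \/ e = (-1)%R ->
    forall i : nat, s (i%:R)%R = (e *+ i + s 0)%R.
  move=> E0 He; elim=> [|i IH]; first by rewrite mulr0n add0r.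
  by rewrite -natr1 (lin _ E0 He) IH mulrSr addrAC.
apply/dihedralP; case: (step 0%R) => E0; [exists false|exists true];
  exists (s 0%R) => x; rewrite -[in LHS](natr_Zp x) (fin _ E0); try tauto;
  by rewrite /dihedral_map ?mulNrn natr_Zp.
Qed.

Lemma eq_perm_cycle_graph s t :
  reflect (exists2 h, h \in dihedral & t = h * s)%g
          (perm_cycle_graph s == perm_cycle_graph t).
Proof.
apply: (iffP eqP) => [[E]|[_ /imsetP[[e k] _ ->] ->]].
  exists (t * s^-1)%g; last by rewrite mulgKV.
  apply: cycle_automorphism_dihedral => i.
  have : [set t i; t (i + 1)%R] \in [set [set t i; t (i + 1)%R] | i : 'Z_n].
    exact: imset_f.
  rewrite -E => /imsetP[j _ Ej]; exists j.
  have := congr1 (fun A : {set 'Z_n} => s^-1%g @: A) Ej.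
  by rewrite !imsetU !imset_set1 !permM !permK.
rewrite /perm_cycle_graph; congr (_, _).
apply/setP => E; apply/imsetP/imsetP => -[i _ ->] /=.
  (* A reflection traverses the edge backwards, so the starting index is the one sent to [i + 1],
     and the endpoints are swapped. *)
  exists (if e then k - (i + 1) else i - k)%R => //.
  rewrite !permM !permE /dihedral_map; case: e.
    rewrite setUC; congr [set s _; s _].
      by rewrite !opprD !opprK; ring.
    by rewrite !opprD !opprK; ring.
  by congr [set s _; s _]; ring.
exists (if e then k - (i + 1) else i + k)%R => //.
rewrite !permM !permE /dihedral_map; case: e.
  by rewrite setUC; congr [set s _; s _]; ring.
by congr [set s _; s _]; ring.
Qed.

Local Notation DD := (setX dihedral_group dihedral_group).

(** Relabelling multiplies [s] by a dihedral map on the right, while the graph determines [s] only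
    up to a dihedral factor on the left. *)
Lemma similar_perm_cycle_graph s t :
  similar_subgraphs (perm_cycle_graph s) (perm_cycle_graph t) =
  (t \in orbit (two_sided_action {perm 'Z_n}) DD s).
Proof.
apply/idP/orbitP => [/existsP[e /existsP[k /eqP E]]|[[h g]]].
  have Eg : perm_cycle_graph (s * dihedral_perm e k)%g == perm_cycle_graph t.
    rewrite E -relabel_perm_cycle_graph; apply/eqP/eq_relabel => x.
    by rewrite permE.
  have /eq_perm_cycle_graph[h hD ->] := Eg.
  exists (h^-1, dihedral_perm e k)%g; last by rewrite /= /two_sided /= invgK mulgA.
  rewrite inE /= groupV hD /=; apply/dihedralP; exists e, k => x.
  by rewrite permE.
rewrite inE /= => /andP[hD /imsetP[[e k] _ ->]] <-.
apply/existsP; exists e; apply/existsP; exists k.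
rewrite -(eq_relabel _ (permE (@dihedral_map_inj e k))) relabel_perm_cycle_graph.
rewrite eq_sym; apply/eq_perm_cycle_graph; exists h^-1%g; rewrite ?groupV//.
by rewrite /two_sided /= mulgA.
Qed.

(** A similarity class is the image of an orbit under [perm_cycle_graph]. Distinct orbits have
    distinct images, since permutations with the same graph share an orbit. *)
Lemma card_similarity_classes :
  #|equivalence_partition (@similar_subgraphs n) (ham_subgraphs n)| =
  #|orbit (two_sided_action {perm 'Z_n}) DD @: setT|.
Proof.
pose to := two_sided_action {perm 'Z_n}.
rewrite /equivalence_partition ham_subgraphsE -imset_comp.
rewrite -(@card_in_imset _ _ (fun A : {set {perm 'Z_n}} => perm_cycle_graph @: A)).
  have E s : [set G in [set perm_cycle_graph t | t : {perm 'Z_n}]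
               | similar_subgraphs (perm_cycle_graph s) G] =
             perm_cycle_graph @: orbit to DD s.
    apply/setP => G; rewrite inE.
    apply/andP/imsetP => [[/imsetP[t _ ->]]|[t ot ->]].
      by rewrite similar_perm_cycle_graph => ot; exists t.
    by rewrite imset_f// similar_perm_cycle_graph.
  rewrite -imset_comp; congr #|pred_of_set _|.
  by apply/setP => A; apply/imsetP/imsetP => -[s _ ->]; exists s => //;
    [exact: E|apply/esym; exact: E].
move=> _ _ /imsetP[s _ ->] /imsetP[t _ ->] E; apply/orbit_eqP.
have : perm_cycle_graph s \in perm_cycle_graph @: orbit to DD s.
  by apply: imset_f; apply: orbit_refl.
rewrite E => /imsetP[t' ot' E'].
apply: orbit_trans ot'; rewrite -similar_perm_cycle_graph E'.
pose G := perm_cycle_graph t'.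
by case: (similar_subgraphs_equivalence G G G).
Qed.

(** The pair [(h, g)] fixes [s] exactly when [h * s = s * g], so the fixed points counted by
    Burnside are intertwiners. *)
Lemma similarity_classes_burnside :
  #|equivalence_partition (@similar_subgraphs n) (ham_subgraphs n)| * (2 * n) ^ 2 =
  \sum_(a : bool * 'Z_n) \sum_(b : bool * 'Z_n)
    #|intertwiners (dihedral_perm a.1 a.2) (dihedral_perm b.1 b.2)|.
Proof.
rewrite card_similarity_classes.
have <- : #|DD| = (2 * n) ^ 2 by rewrite cardsX /= card_dihedral.
rewrite -Frobenius_Cauchy; last by apply/actsP => a _ s; rewrite !inE.
rewrite (eq_bigr (fun a => #|intertwiners a.1 a.2|)); last first.
  move=> [h g] _; apply: eq_card => s; rewrite in_setI in_setT [RHS]inE.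
  apply/afix1P/eqP => /= [|E]; rewrite /two_sided /=.
    by move=> Es; rewrite -[in LHS]Es -mulgA mulKVg.
  by rewrite -mulgA -E mulKg.
rewrite (eq_bigl (fun a => (a.1 \in dihedral) && (a.2 \in dihedral))); last first.
  by move=> a; rewrite inE.
rewrite -(pair_big (mem dihedral) (mem dihedral) (fun h g => #|intertwiners h g|)) /=.
rewrite (big_imset _ (in2W dihedral_perm_inj)) /=.
by apply: eq_bigr => a _; rewrite (big_imset _ (in2W dihedral_perm_inj)).
Qed.

End CycleGraphs.

(** * Summing over pairs of dihedral maps *)

(** With n = m d, the residues whose gcd with n is d are the i d with i < m coprime to m. *)
Lemma count_gcdn_eq n d : 0 < n -> d %| n ->
  \sum_(k < n) (gcdn n k == d) = totient (n %/ d).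
Proof.
move=> n_gt0 /dvdnP[m En]; rewrite {}En in n_gt0 *.
have [m_gt0 d_gt0] : 0 < m /\ 0 < d by move: n_gt0; rewrite muln_gt0 => /andP[].
rewrite mulnK// totient_count_coprime big_mkord.
have f_lt (i : 'I_m) : i * d < m * d by rewrite ltn_pmul2r.
pose f i := Ordinal (f_lt i).
have f_inj : injective f.
  by move=> i j /(congr1 val)/= /eqP; rewrite eqn_pmul2r// => /eqP/val_inj.
have E (i : 'I_m) : (gcdn (m * d) (f i) == d) = coprime m i.
  by rewrite /= -muln_gcdl -{2}[d]mul1n eqn_pmul2r.
rewrite -(eq_bigr _ (fun i _ => congr1 nat_of_bool (E i))).
rewrite -(big_imset (fun k : 'I_(m * d) => nat_of_bool (gcdn (m * d) k == d)) (in2W f_inj)).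
rewrite [LHS](bigID (mem (f @: 'I_m))) /= addnC big1 ?add0n// => k kf.
apply/eqP; rewrite eqb0; apply: contra kf => /eqP Ed.
have /dvdnP[i Ei] : d %| k by have := dvdn_gcdr (m * d) k; rewrite Ed.
have i_lt : i < m by have := ltn_ord k; rewrite {1}Ei ltn_pmul2r.
by apply/imsetP; exists (Ordinal i_lt) => //; apply: val_inj.
Qed.

Lemma sum_gcdn_divisors n (F : nat -> nat) : 0 < n ->
  \sum_(k < n) F (gcdn n k) = \sum_(d <- divisors n) totient (n %/ d) * F d.
Proof.
move=> n_gt0.
transitivity (\sum_(d <- divisors n) \sum_(k < n) (gcdn n k == d) * F d).
  rewrite exchange_big; apply: eq_bigr => k _.
  rewrite (bigD1_seq (gcdn n k)) ?divisors_uniq//=; last first.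
    by rewrite -dvdn_divisors// dvdn_gcdl.
  rewrite eqxx mul1n big1 ?addn0// => d.
  by rewrite eq_sym => /negPf->.
rewrite big_seq [RHS]big_seq; apply: eq_bigr => d.
by rewrite -dvdn_divisors// => dn; rewrite -big_distrl /= count_gcdn_eq.
Qed.

Lemma sum_odd q : \sum_(k < q.*2) odd k = q.
Proof.
elim: q => [|q IH]; first by rewrite big_ord0.
by rewrite doubleS !big_ord_recr /= IH odd_double /=; lia.
Qed.

Lemma sum_even q : \sum_(k < q.*2) ~~ odd k = q.
Proof.
elim: q => [|q IH]; first by rewrite big_ord0.
by rewrite doubleS !big_ord_recr /= IH odd_double /=; lia.
Qed.

Lemma double_factorial_double q : double_factorial q.*2 = q`! * 2 ^ q.
Proof.
rewrite /double_factorial odd_double; elim: q => [|q IH].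
  by rewrite big_geq.
rewrite doubleS big_mkcond big_nat_recr// big_nat_recr//= -big_mkcond /=.
by rewrite IH odd_double /= factS expnS -muln2; lia.
Qed.

(** After division by the gcd, n and k become coprime. This yields the additive order of [k] in
    Z/n. *)
Lemma dvdn_mul_gcd n k j : 0 < n -> (n %| k * j) = (n %/ gcdn n k %| j).
Proof.
move=> n_gt0; have g_gt0 : 0 < gcdn n k by rewrite gcdn_gt0 n_gt0.
have co : coprime (n %/ gcdn n k) (k %/ gcdn n k).
  rewrite /coprime -(eqn_pmul2r g_gt0) muln_gcdl.
  by rewrite !divnK ?dvdn_gcdl ?dvdn_gcdr ?mul1n.
rewrite -(Gauss_dvdr _ co) -[RHS](dvdn_pmul2r g_gt0) mulnAC.
by rewrite !divnK ?dvdn_gcdl ?dvdn_gcdr.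
Qed.

Lemma double_modn_eq0 n y : ~~ odd n -> y < n ->
  (y * 2 %% n == 0) = (y == 0) || (y == n./2).
Proof.
move=> n_even y_lt; apply/idP/orP => [/dvdnP[[|[|q]]] E|[]/eqP->].
- by left; lia.
- by right; lia.
- by move: E; rewrite !mulSn; lia.
- by rewrite mod0n.
by rewrite muln2 halfK (negPf n_even) subn0 modnn.
Qed.

(** Serves to recognise the half turn as the only rotation of order 2. *)
Lemma eq_half_of_dvdn n g k :
  2 * g = n -> g %| k -> k < n -> k != 0 -> k = n./2.
Proof.
move=> <- /dvdnP[[|[|q]] ->]; rewrite ?mulSn; lia.
Qed.

(** * Cycle types of dihedral maps and the resulting intertwiner counts *)

Section DihedralCount.
Variable p : nat.
Local Notation n := p.+3.
Local Notation rotation := (@dihedral_perm p false).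
Local Notation reflection := (@dihedral_perm p true).
Implicit Types k l x : 'Z_n.

Lemma rotation_expg k j x : (rotation k ^+ j)%g x = (x + k *+ j)%R.
Proof.
elim: j => [|j IH]; first by rewrite expg0 perm1 mulr0n addr0.
by rewrite expgSr permM IH permE /dihedral_map mulrSr addrA.
Qed.

Lemma reflection_expg k j x :
  (reflection k ^+ j)%g x = if odd j then (k - x)%R else x.
Proof.
elim: j => [|j IH]; first by rewrite expg0 perm1.
rewrite expgSr permM IH permE /dihedral_map /=.
by case: (odd j) => /=; ring.
Qed.

Lemma Zp_mulrn_eq0 k j : (k *+ j == 0)%R = (n %/ gcdn n k %| j).
Proof.
by rewrite Zp_mulrn -val_eqE /= -/(dvdn n (k * j)) dvdn_mul_gcd.
Qed.

Lemma rotation_cycles k : cycles_of_length (n %/ gcdn n k) (rotation k).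
Proof.
move=> x j _; rewrite rotation_expg -Zp_mulrn_eq0.
by rewrite -subr_eq0 addrAC subrr add0r.
Qed.

Lemma reflection_cycles k : cycles_of_length 2 (reflection k).
Proof.
move=> x j; have := reflection_expg k 1 x; rewrite expg1 => ->.
by rewrite reflection_expg dvdn2 /=; case: (odd j) => [/negPf|] //; rewrite eqxx.
Qed.

Lemma card_fixpoints_rotation k :
  #|fixpoints (rotation k)| = if k == 0%R then n else 0.
Proof.
have E x : (x \in fixpoints (rotation k)) = (k == 0%R).
  by rewrite inE permE /dihedral_map -subr_eq0 addrAC subrr add0r.
case: eqP E => _ E; last by apply: eq_card0 => x; rewrite E.
by rewrite -[RHS](card_ord n); apply: eq_card => x; rewrite E.
Qed.

Lemma in_fixpoints_reflection k x :
  (x \in fixpoints (reflection k)) = (x + x == k)%R.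
Proof.
by rewrite inE permE /dihedral_map addrC subr_eq eq_sym.
Qed.

(** The fixed points solve 2x = k, and doubling is a bijection of Z/n for odd n. *)
Lemma card_fixpoints_reflection_odd k : odd n -> #|fixpoints (reflection k)| = 1.
Proof.
move=> n_odd.
have dbl_inj : injective (fun x => x + x)%R.
  move=> x y /eqP; rewrite -subr_eq0 => /eqP E.
  apply/eqP; rewrite -subr_eq0; move: E.
  have -> : (x + x - (y + y) = (x - y) *+ 2)%R by rewrite mulr2n; ring.
  move=> /eqP; rewrite Zp_mulrn_eq0; set z : 'Z_n := (x - y)%R.
  rewrite dvdn_divLR ?dvdn_gcdl ?gcdn_gt0// Gauss_dvdr; last first.
    by rewrite coprimen2.
  move=> /dvdn_leq => H; apply/eqP/val_inj => /=.
  case Ez: (z : nat) => [//|z'].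
  have : n <= gcdn n z by apply: H; rewrite gcdn_gt0.
  by rewrite leqNgt (leq_ltn_trans _ (ltn_ord z))// dvdn_leq ?Ez// -Ez dvdn_gcdr.
have [g gK Kg] := injF_bij dbl_inj.
rewrite -(cards1 (g k)); apply: eq_card => x.
by rewrite in_fixpoints_reflection inE -[in RHS](inj_eq dbl_inj) Kg.
Qed.

Lemma odd_Zp_add x : ~~ odd n -> odd (x + x)%R = false.
Proof.
move=> n_even; rewrite /= -[RHS](odd_double x) -addnn [in RHS](divn_eq (x + x) n).
by rewrite [in RHS]oddD oddM (negPf n_even) andbF.
Qed.

(** For even n, doubles in Z/n are even, so 2x = k has no solution for odd k; for even k the
    solutions are k/2 and k/2 + n/2. *)
Lemma card_fixpoints_reflection_even k : ~~ odd n ->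
  #|fixpoints (reflection k)| = if odd k then 0 else 2.
Proof.
move=> n_even; case: ifPn => k_odd.
  apply: eq_card0 => x; rewrite in_fixpoints_reflection.
  by apply: contraTF k_odd => /eqP<-; rewrite odd_Zp_add.
pose c : 'Z_n := inZp k./2; pose h : 'Z_n := inZp n./2.
have kc : k = (c + c)%R.
  apply: val_inj; rewrite /= modnDm addnn halfK (negPf k_odd) subn0.
  by rewrite modn_small.
have n2_lt : n./2 < n by lia.
have hv : h = n./2 :> nat := modn_small n2_lt.
have h_neq0 : h != 0%R by apply/eqP => E; move: hv; rewrite E.
rewrite -(_ : #|[set c; (c + h)%R]| = 2); last first.
  by rewrite cards2 -{1}[c]addr0 (inj_eq (addrI c)) eq_sym h_neq0.
apply: eq_card => x; rewrite in_fixpoints_reflection !inE kc.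
rewrite -subr_eq0 -[x == c]subr_eq0 -[x == (c + h)%R]subr_eq0.
have -> : (x + x - (c + c) = (x - c) *+ 2)%R by rewrite mulr2n; ring.
have -> : (x - (c + h) = (x - c) - h)%R by ring.
rewrite [(_ - h == 0)%R]subr_eq0; set y := (x - c)%R.
rewrite Zp_mulrn -!val_eqE -[val h]/(nat_of_ord h) hv.
exact: double_modn_eq0.
Qed.

(** A rotation by [k] has gcd(n, k) cycles of length n / gcd(n, k), so the gcd determines its cycle
    type. The identity is separate because its cycles have length 1; its n fixed points give n!, in
    agreement with the formula. *)
Lemma card_intertwiners_rotation k l :
  #|intertwiners (rotation k) (rotation l)| =
  if gcdn n k == gcdn n l then (n %/ gcdn n k) ^ gcdn n k * (gcdn n k)`! else 0.
Proof.
have mem0 (g h : {perm 'Z_n}) : (forall s, s \notin intertwiners g h) ->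
    #|intertwiners g h| = 0.
  by move=> H; apply: eq_card0 => s; apply/negbTE.
have gcd_eq (x : 'Z_n) : (gcdn n x == n) = (x == 0%R).
  rewrite -val_eqE /=; apply/eqP/eqP => [E|->]; last by rewrite gcdn0.
  case Ex: (x : nat) => [//|x'].
  have := ltn_ord x; rewrite ltnNge -{1}E dvdn_leq ?dvdn_gcdr//.
  by rewrite Ex.
have [k0|k0] := eqVneq k 0%R.
  have gk : gcdn n k = n by apply/eqP; rewrite gcd_eq k0.
  rewrite gk eq_sym gcd_eq divnn /= exp1n mul1n.
  have [l0|l0] := eqVneq l 0%R.
    (* For the identity the length condition is vacuous: take n fixed points and no cycles, with
       nominal length 2. *)
    rewrite (@card_intertwiners _ _ _ 0 n 0) ?card_ord ?addn0//.
    - by rewrite expn0 !muln1.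
    - by move=> x j; rewrite permE /dihedral_map k0 addr0 eqxx.
    - by move=> x j; rewrite permE /dihedral_map l0 addr0 eqxx.
    - by rewrite card_fixpoints_rotation k0 eqxx.
    - by rewrite card_fixpoints_rotation l0 eqxx.
  apply: mem0 => s; apply/negP => /intertwiners_fixpoints.
  by rewrite !card_fixpoints_rotation k0 eqxx (negPf l0).
have fk : #|fixpoints (rotation k)| = 0 by rewrite card_fixpoints_rotation (negPf k0).
have mE (x : 'Z_n) : x != 0%R -> 1 < n %/ gcdn n x.
  move=> x0; rewrite ltn_divRL ?dvdn_gcdl// mul1n ltn_neqAle gcd_eq x0.
  by rewrite dvdn_leq ?dvdn_gcdl.
case: ifPn => [/eqP Ekl|ne].
  have l0 : l != 0%R by rewrite -gcd_eq -Ekl gcd_eq.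
  have := @rotation_cycles l; have := @rotation_cycles k; rewrite -Ekl.
  have mk := mE _ k0; have mn := divnK (dvdn_gcdl n k).
  case: (n %/ gcdn n k) mk mn => [|[|m]]// _ mn ck cl.
  rewrite (@card_intertwiners _ _ _ m 0 (gcdn n k))//.
  - by rewrite fact0 mul1n mulnC.
  - by rewrite card_fixpoints_rotation (negPf l0).
  - by rewrite card_ord add0n mulnC mn.
apply: mem0 => s; apply: contra ne => si.
have gx : rotation k 0%R != 0%R by rewrite permE /dihedral_map add0r.
have := intertwiners_length si gx (@rotation_cycles k) (@rotation_cycles l).
move=> E; rewrite -(@eqn_pmul2l (n %/ gcdn n k)); last exact: ltnW (mE _ k0).
by rewrite {2}E !(mulnC (_ %/ _)) !(mulnC (gcdn _ _)) !divnK ?dvdn_gcdl.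
Qed.

(** For given [k] with gcd d, exactly totient(n/d) values of [l] share this gcd; summing over [k]
    brings the second totient factor. *)
Lemma sum_intertwiners_rotation :
  \sum_k \sum_l #|intertwiners (rotation k) (rotation l)| =
  \sum_(d <- divisors n) totient (n %/ d) ^ 2 * ((n %/ d) ^ d * d`!).
Proof.
pose F d := totient (n %/ d) * ((n %/ d) ^ d * d`!).
transitivity (\sum_(k < n) F (gcdn n k)).
  apply: eq_bigr => k _.
  under eq_bigr do rewrite card_intertwiners_rotation.
  rewrite /F -count_gcdn_eq ?dvdn_gcdl// big_distrl /=.
  by apply: eq_bigr => l _; rewrite eq_sym; case: eqP => _; rewrite ?mul1n.
by rewrite sum_gcdn_divisors//; apply: eq_bigr => d _; rewrite /F mulnA.
Qed.

(** Every reflection has one fixed point and (n-1)/2 transpositions. *)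
Lemma card_intertwiners_reflection_odd k l : odd n ->
  #|intertwiners (reflection k) (reflection l)| = double_factorial (n - 1).
Proof.
move=> n_odd; have En : n = 1 + n./2 * 2 by rewrite -{1}[n]odd_double_half n_odd muln2.
rewrite (@card_intertwiners _ _ _ 0 1 n./2) ?card_ord ?card_fixpoints_reflection_odd//;
  try exact: reflection_cycles.
have -> : n - 1 = n./2.*2 by lia.
by rewrite double_factorial_double mul1n.
Qed.

Lemma card_intertwiners_mixed_odd k l : odd n ->
  #|intertwiners (rotation k) (reflection l)| = 0.
Proof.
move=> n_odd; apply: eq_card0 => s; apply/negbTE/negP => /intertwiners_fixpoints.
by rewrite card_fixpoints_rotation card_fixpoints_reflection_odd//; case: eqP.
Qed.

(** Reflections have n/2 transpositions for odd [k], and two fixed points with n/2 - 1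
    transpositions for even [k]. Parities enter as 0/1 factors so that the double sum splits into
    products. *)
Lemma card_intertwiners_reflection_even k l : ~~ odd n ->
  #|intertwiners (reflection k) (reflection l)| =
  odd k * odd l * (n./2`! * 2 ^ n./2) +
  ~~ odd k * ~~ odd l * (2 * ((n./2.-1)`! * 2 ^ n./2.-1)).
Proof.
move=> n_even; have En : n = n./2 * 2.
  by rewrite -{1}[n]odd_double_half (negPf n_even) muln2.
have [Ekl|ne] := eqVneq (odd k) (odd l); last first.
  rewrite eq_card0; first by move: ne; case: (odd k) (odd l) => [] [].
  move=> s; apply/negbTE/negP => /intertwiners_fixpoints.
  rewrite !card_fixpoints_reflection_even//.
  by move: ne; case: (odd k) (odd l) => [] [].
pose f := if odd k then 0 else 2.
rewrite (@card_intertwiners _ _ _ 0 f (if odd k then n./2 else n./2.-1));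
  try exact: reflection_cycles.
- by rewrite /f -Ekl; case: (odd k); rewrite /= ?mul1n ?mul0n ?addn0 ?add0n ?mul1n.
- by rewrite card_fixpoints_reflection_even.
- by rewrite card_fixpoints_reflection_even// -Ekl.
apply: etrans (esym (card_ord n)); apply: etrans (esym En).
by rewrite /f; case: (odd k); [rewrite add0n|rewrite -mulSn prednK].
Qed.

(** Comparing fixed points forces [l] odd and [k] nonzero; comparing cycle lengths then forces order
    2, that is the half turn. *)
Lemma card_intertwiners_mixed_even k l : ~~ odd n ->
  #|intertwiners (rotation k) (reflection l)| =
  (k == inZp n./2) * (odd l * (n./2`! * 2 ^ n./2)).
Proof.
move=> n_even; have En : n = n./2 * 2.
  by rewrite -{1}[n]odd_double_half (negPf n_even) muln2.
pose h : 'Z_n := inZp n./2.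
have n2_lt : n./2 < n by lia.
have hv : h = n./2 :> nat := modn_small n2_lt.
have h0 : h != 0%R by apply/eqP => E; move: hv; rewrite E.
have [l_odd|l_even] := boolP (odd l); last first.
  rewrite mul0n muln0; apply: eq_card0 => s; apply/negbTE/negP.
  move=> /intertwiners_fixpoints; rewrite card_fixpoints_rotation.
  by rewrite card_fixpoints_reflection_even// (negPf l_even); case: eqP.
have fl : #|fixpoints (reflection l)| = 0.
  by rewrite card_fixpoints_reflection_even// l_odd.
rewrite -/h mul1n; have [->|ne] := eqVneq k h.
  rewrite (@card_intertwiners _ _ _ 0 0 n./2) ?mul1n//; last first.
  - by rewrite card_ord add0n -En.
  - by rewrite card_fixpoints_rotation (negPf h0).
  - exact: reflection_cycles.
  have := @rotation_cycles h.
  have -> : n %/ gcdn n h = 2; last by [].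
  rewrite hv {2}En gcdnC gcdnMr {1}En mulKn//; lia.
rewrite mul0n; apply: eq_card0 => s; apply/negbTE/negP => si.
have k0 : k != 0%R.
  have := intertwiners_fixpoints si; rewrite fl card_fixpoints_rotation.
  by case: eqP.
have gx : rotation k 0%R != 0%R by rewrite permE /dihedral_map add0r.
have E := intertwiners_length si gx (@rotation_cycles k) (@reflection_cycles l).
have := divnK (dvdn_gcdl n k); rewrite E => Eg.
case/eqP: ne; apply: val_inj; rewrite -[val h]/(nat_of_ord h) hv.
apply: (eq_half_of_dvdn Eg (dvdn_gcdr n k) (ltn_ord k)).
by apply: contra k0 => /eqP Ek; apply/eqP/val_inj.
Qed.

(** The two mixed sums agree by inverting the intertwiners, hence the factor 2. *)
Lemma sum_intertwiners_dihedral :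
  \sum_(a : bool * 'Z_n) \sum_(b : bool * 'Z_n)
    #|intertwiners (dihedral_perm a.1 a.2) (dihedral_perm b.1 b.2)| =
  \sum_k \sum_l #|intertwiners (rotation k) (rotation l)| +
  (\sum_k \sum_l #|intertwiners (reflection k) (reflection l)| +
   2 * \sum_k \sum_l #|intertwiners (rotation k) (reflection l)|).
Proof.
have split_sum (F : bool * 'Z_n -> nat) :
    \sum_a F a = \sum_k F (false, k) + \sum_k F (true, k).
  rewrite (eq_bigr (fun a => F (a.1, a.2))); last by case.
  by rewrite -(pair_bigA _ (fun e k => F (e, k))) /= big_bool addnC.
rewrite split_sum; under eq_bigr do rewrite split_sum /=.
under [X in _ + X]eq_bigr do rewrite split_sum /=.
rewrite !big_split /=.
have -> : \sum_k \sum_l #|intertwiners (reflection k) (rotation l)| =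
          \sum_k \sum_l #|intertwiners (rotation k) (reflection l)|.
  rewrite exchange_big; apply: eq_bigr => k _; apply: eq_bigr => l _.
  exact: card_intertwinersC.
rewrite -!addnA; congr (_ + _).
by rewrite addnA addnC mul2n addnn.
Qed.

Lemma sum_intertwiners_reflections_odd : odd n ->
  \sum_k \sum_l #|intertwiners (reflection k) (reflection l)| +
   2 * (\sum_k \sum_l #|intertwiners (rotation k) (reflection l)|) =
  n ^ 2 * double_factorial (n - 1).
Proof.
move=> n_odd.
under eq_bigr do under eq_bigr do rewrite card_intertwiners_reflection_odd//.
under [X in _ + 2 * X]eq_bigr do
  under eq_bigr do rewrite card_intertwiners_mixed_odd//.
by rewrite !sum_nat_const !card_ord !muln0 addn0 mulnA.
Qed.

Lemma sum_intertwiners_reflections_even : ~~ odd n ->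
  \sum_k \sum_l #|intertwiners (reflection k) (reflection l)| +
   2 * (\sum_k \sum_l #|intertwiners (rotation k) (reflection l)|) =
  double_factorial n * (n./2 * (n./2 + 3)).
Proof.
move=> n_even; have En : n./2.*2 = n.
  by rewrite -[RHS]odd_double_half (negPf n_even).
have s_odd : \sum_(k : 'Z_n) odd k = n./2 by rewrite -[RHS]sum_odd En.
have s_even : \sum_(k : 'Z_n) ~~ odd k = n./2 by rewrite -[RHS]sum_even En.
have -> : double_factorial n = n./2`! * 2 ^ n./2.
  by rewrite -[in LHS]En double_factorial_double.
under eq_bigr do under eq_bigr do rewrite card_intertwiners_reflection_even//.
under [X in _ + 2 * X]eq_bigr do
  under eq_bigr do rewrite card_intertwiners_mixed_even//.
set A := n./2`! * 2 ^ n./2; set B := 2 * _.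
(* With q = n/2, this turns q^2 A + q^2 B + 2qA into (q^2 + 3q) A. *)
have EB : n./2 * B = A.
  rewrite /A /B; have : 0 < n./2 by [].
  by case: (n./2) => // q _ /=; rewrite factS expnS; lia.
transitivity (n./2 * n./2 * A + n./2 * n./2 * B + 2 * (n./2 * A)); last first.
  by rewrite -EB; ring.
congr (_ + 2 * _).
  under eq_bigr do rewrite big_split /= -!big_distrl /= -!big_distrr /= s_odd s_even.
  by rewrite big_split /= -!big_distrl /= s_odd s_even.
under eq_bigr do rewrite -big_distrr /= -big_distrl /= s_odd.
rewrite -big_distrl /= (bigD1 (inZp n./2))//= eqxx big1 ?addn0 ?mul1n//.
by move=> k /negPf->.
Qed.

End DihedralCount.

(** * Assembling the count and passing to rationals *)

Lemma card_similarity_classesE (p : nat) (n := p.+3) :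
  #|equivalence_partition (@similar_subgraphs n) (ham_subgraphs n)| * (2 * n) ^ 2 =
  \sum_(d <- divisors n) totient (n %/ d) ^ 2 * ((n %/ d) ^ d * d`!) +
  (if odd n then n ^ 2 * double_factorial (n - 1)
   else double_factorial n * (n./2 * (n./2 + 3))).
Proof.
rewrite similarity_classes_burnside sum_intertwiners_dihedral.
rewrite sum_intertwiners_rotation; congr (_ + _); case: ifPn.
  exact: sum_intertwiners_reflections_odd.
exact: sum_intertwiners_reflections_even.
Qed.

Local Open Scope ring_scope.

Theorem theorem8 (n : nat) (hn : (3 <= n)%N) :
  #|equivalence_partition (@similar_subgraphs n) (ham_subgraphs n)|%:R =
    1 / (4 * n%:R ^+ 2) *
    (\sum_(d <- divisors n)
        (totient (n %/ d)%N)%:R ^+ 2 * (n %/ d)%N%:R ^+ d * (d`!)%:R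
     + (if odd n
        then n%:R ^+ 2 * (double_factorial (n - 1)%N)%:R
        else (double_factorial n)%:R * (n%:R * (n%:R + 6) / 4)))
  :> rat.
Proof.
case: n hn => [|[|[|p]]] // _; set n := p.+3.
have n0 : n%:R != 0 :> rat by rewrite Num.Theory.pnatr_eq0.
have /(congr1 (fun m => m%:R : rat)) := card_similarity_classesE p.
rewrite -/n natrM natrX natrM natrD => E.
set S := \sum_(d <- _) _ in E *.
have ES : S%:R = \sum_(d <- divisors n)
    (totient (n %/ d)%N)%:R ^+ 2 * (n %/ d)%N%:R ^+ d * (d`!)%:R :> rat.
  by rewrite natr_sum; apply: eq_bigr => d _; rewrite !natrM !natrX mulrA.
have ER : (if odd n then n ^ 2 * double_factorial (n - 1)
   else double_factorial n * (n./2 * (n./2 + 3)))%N%:R =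
  (if odd n then n%:R ^+ 2 * (double_factorial (n - 1)%N)%:R
   else (double_factorial n)%:R * (n%:R * (n%:R + 6) / 4)) :> rat.
  case: ifPn => n_odd; first by rewrite natrM natrX.
  (* With n = 2q, n(n+6)/4 becomes q(q+3). *)
  have -> : n%:R = 2 * n./2%:R :> rat.
    by rewrite -natrM mul2n halfK (negPf n_odd) subn0.
  by rewrite !natrM natrD; field.
rewrite -ES -ER -E; field; exact: n0.
Qed.
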